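(* Let $E:\mathbb R^d\to\mathbb R$ be twice continuously differentiable, $F=-\nabla E$, $J=-\nabla^2E$, and suppose Assumption A (stated in the context) holds. Fix $T>0$, $1\le k\le d$, $\beta,\gamma>0$, an initial state $x_0\in\mathbb R^d$ and orthonormal vectors $v_{1,0},\dots,v_{k,0}\in\mathbb R^d$. For $N\in\mathbb N$ let $\tau=T/N$ and let $x_n$, $v_{i,n}$ ($1\le n\le N$, $1\le i\le k$) be generated by the discrete HiSD scheme given in the context. Then for $\tau$ small enough, $$\frac{v_{i,n}-v_{i,n-1}}{\tau}=\mathcal R_i^{n-1}+\mathcal L_i^{n-1}+O(\tau),\qquad 1\le n\le N,\ 1\le i\le k,$$ where $$\mathcal R_i^{n-1}=\gamma J(x_{n-1})v_{i,n-1},\qquad \mathcal L_i^{n-1}=\gamma\Big(-v_{i,n-1}v_{i,n-1}^\top-2\sum_{j=1}^{i-1}v_{j,n-1}v_{j,n-1}^\top\Big)J(x_{n-1})v_{i,n-1}.$$ That is, there exist $\tau_0>0$ and $Q>0$, independent of $\tau$, $n$, $N$ and $i$, such that whenever $\tau\le\tau_0$ one has $\big\|\frac{v_{i,n}-v_{i,n-1}}{\tau}-\mathcal R_i^{n-1}-\mathcal L_i^{n-1}\big\|\le Q\tau$ for all $1\le n\le N$ and $1\le i\le k$.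
   Context: $\|\cdot\|$ is the Euclidean ($l^2$) norm of a vector, or the induced norm of a matrix; $I$ is the $d\times d$ identity. Assumption A: there is a constant $L>0$ such that for all $x,x_1,x_2\in\mathbb R^d$, $\|J(x_2)-J(x_1)\|+\|F(x_2)-F(x_1)\|\le L\|x_2-x_1\|$ and $\|F(x)\|\le L(1+\|x\|)$. Discrete HiSD scheme: starting from $x_0$ and orthonormal $\{v_{i,0}\}_{i=1}^k$, for $n=1,\dots,N$, $$x_n=x_{n-1}+\tau\beta\Big(I-2\sum_{j=1}^k v_{j,n-1}v_{j,n-1}^\top\Big)F(x_{n-1}),$$ $$\tilde v_{i,n}=v_{i,n-1}+\tau\gamma J(x_{n-1})v_{i,n-1},\quad 1\le i\le k,$$ and then, successively for $i=1,\dots,k$ (Gram–Schmidt orthonormalization), $$v_{i,n}=\frac1{Y_{i,n}}\Big(\tilde v_{i,n}-\sum_{j=1}^{i-1}(\tilde v_{i,n}^\top v_{j,n})v_{j,n}\Big),\qquad Y_{i,n}=\Big\|\tilde v_{i,n}-\sum_{j=1}^{i-1}(\tilde v_{i,n}^\top v_{j,n})v_{j,n}\Big\|$$ (for $\tau$ sufficiently small $Y_{i,n}\neq0$). Constants may depend on $E$, $L$, $d$, $k$, $\beta$, $\gamma$, $T$ and the initial data. *)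

(* Defs.v *)
From mathcomp Require Import all_boot all_order all_algebra.
From mathcomp Require Import all_classical all_reals all_analysis.

Set Implicit Arguments.
Unset Strict Implicit.
Unset Printing Implicit Defensive.

Import Order.TTheory GRing.Theory Num.Theory.
Import numFieldNormedType.Exports.

Local Open Scope classical_set_scope.
Local Open Scope ring_scope.

Definition dot (R : realType) (d : nat) (u v : 'cV[R]_d) : R :=
  (u^T *m v) 0 0.

(* The library norm `|v| on matrices is the sup norm, so the Euclidean norm and
   the matrix norm it induces are defined here. *)
Definition enorm (R : realType) (d : nat) (v : 'cV[R]_d) : R :=
  Num.sqrt (\sum_i v i 0 ^+ 2).

Definition opnorm (R : realType) (d : nat) (A : 'M[R]_d) : R :=
  sup [set enorm (A *m v) | v in [set v : 'cV[R]_d | enorm v <= 1]].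

Definition grad (R : realType) (d : nat) (E : 'cV[R]_d -> R) (x : 'cV[R]_d) :
    'cV[R]_d :=
  \col_i 'D_(delta_mx i 0) E x.

Definition hess (R : realType) (d : nat) (E : 'cV[R]_d -> R) (x : 'cV[R]_d) :
    'M[R]_d :=
  \matrix_(i, j) 'D_(delta_mx j 0) (fun y => grad E y i 0) x.

(* The topology of the sup norm coincides with the Euclidean one, so Frechet
   differentiability and continuity have their usual meaning. *)
Definition twice_continuously_differentiable (R : realType) (d : nat)
    (E : 'cV[R]_d -> R) : Prop :=
  [/\ forall x, differentiable E x,
      forall x, differentiable (grad E) x
    & continuous (hess E)].

Definition assumptionA (R : realType) (d : nat)
    (F : 'cV[R]_d -> 'cV[R]_d) (J : 'cV[R]_d -> 'M[R]_d) : Prop :=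
  exists2 L : R, 0 < L &
    (forall x1 x2, opnorm (J x2 - J x1) + enorm (F x2 - F x1)
                     <= L * enorm (x2 - x1)) /\
    (forall x, enorm (F x) <= L * (1 + enorm x)).

Definition orthonormal_family (R : realType) (d k : nat)
    (v : 'I_k -> 'cV[R]_d) : Prop :=
  forall i j, dot (v i) (v j) = (i == j)%:R.

(* The vector indexed by i : 'I_k is the (i+1)-st one of the usual 1-based
   numbering.  Since 0^-1 = 0, a breakdown of the orthonormalization (zero norm)
   yields the zero vector. *)
Definition hisd_scheme (R : realType) (d k : nat)
    (F : 'cV[R]_d -> 'cV[R]_d) (J : 'cV[R]_d -> 'M[R]_d) (beta gamma tau : R)
    (N : nat) (x : nat -> 'cV[R]_d) (v : 'I_k -> nat -> 'cV[R]_d) : Prop :=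
  forall n, (1 <= n <= N)%N ->
    x n = x n.-1 + (tau * beta) *:
            ((1%:M - 2 *: \sum_j (v j n.-1 *m (v j n.-1)^T)) *m F (x n.-1)) /\
    forall i,
      let vt := v i n.-1 + (tau * gamma) *: (J (x n.-1) *m v i n.-1) in
      let w := vt - \sum_(j < k | (j < i)%N) dot vt (v j n) *: v j n in
      let Y := enorm w in
      v i n = Y^-1 *: w.

Definition Rterm (R : realType) (d k : nat) (J : 'cV[R]_d -> 'M[R]_d)
    (gamma : R) (x : 'cV[R]_d) (v : 'I_k -> 'cV[R]_d) (i : 'I_k) : 'cV[R]_d :=
  gamma *: (J x *m v i).

Definition Lterm (R : realType) (d k : nat) (J : 'cV[R]_d -> 'M[R]_d)
    (gamma : R) (x : 'cV[R]_d) (v : 'I_k -> 'cV[R]_d) (i : 'I_k) : 'cV[R]_d :=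
  gamma *: ((- (v i *m (v i)^T)
             - 2 *: \sum_(j < k | (j < i)%N) (v j *m (v j)^T)) *m (J x *m v i)).

(* Main.v *)
Require Import Defs.
From mathcomp Require Import all_boot all_order all_algebra.
From mathcomp Require Import all_classical all_reals all_analysis.
From mathcomp Require Import ring lra.

Set Implicit Arguments.
Unset Strict Implicit.
Unset Printing Implicit Defensive.

Import Order.TTheory GRing.Theory Num.Theory.
Import numFieldNormedType.Exports.

Local Open Scope classical_set_scope.
Local Open Scope ring_scope.

(** Write A = gamma J(x_{n-1}), let v_i be the frame before a step and u_i the
frame after it.  The theorem is a statement about a single step: as soon as
the v_i are orthonormal, A is symmetric and its entries are bounded by a
constant M, one has u_i = v_i + tau p_i + O(tau^2), where
    p_i = A v_i - (v_i . A v_i) v_i - 2 sum_(j < i) (v_j . A v_i) v_j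
is R_i + L_i, and where O depends only on M (and d, k).

All hypotheses of this local statement hold along the whole trajectory.
- J is minus a continuous Hessian, so it is symmetric; this is proved here
  (schwarz_symmetry) with the mean value theorem on second differences.
- The entries of J are directional derivatives of F, and F is L-Lipschitz, so
  they are bounded by L everywhere (hess_entry_le), wherever x_{n-1} lies.
- The new frame is orthonormal when no residual vanishes, which the local
  expansion itself gives for tau small; so orthonormality propagates from
  v_{i,0} by induction on n, with a threshold on tau independent of n.

The local expansion goes by strong induction on i.  If u_j = v_j + tau p_j
+ O(tau^2) for j < i, then, v_i being orthogonal to the v_l with l <= j,
    (v_i + tau A v_i) . u_j = tau (v_i . A v_j + v_j . A v_i) + O(tau^2)
                            = 2 tau (v_j . A v_i) + O(tau^2)
by symmetry of A; this is where the factor 2 comes from.  Hence the residual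
is v_i + tau g_i + O(tau^2) with g_i = A v_i - 2 sum_(j < i) (v_j . A v_i) v_j,
and dividing by its norm 1 + tau (v_i . g_i) + O(tau^2) removes from g_i its
component along v_i, which is (v_i . A v_i) v_i (normalize_expansion).

Uniformity of the constants is obtained by regarding all the data of a step
(tau, A, v, u) as one point of a type of admissible steps, and O(tau^m) as an
asymptotic estimate along the filter of admissible steps with tau -> 0. *)

(** * Symmetry and boundedness of the Hessian *)

Lemma is_derive_line {R : realType} {V : normedModType R} (f : V -> R)
    (x v : V) (s : R) :
  derivable f (x + s *: v) v ->
  is_derive s 1 (fun r : R => f (x + r *: v)) ('D_v f (x + s *: v)).
Proof.
move=> df.
have E : (fun h : R => h^-1 *:
    (((fun r : R => f (x + r *: v)) \o shift s) (h *: 1) - f (x + s *: v)))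
  = (fun h : R => h^-1 *: ((f \o shift (x + s *: v)) (h *: v) - f (x + s *: v))).
  apply/funext => h /=; congr (_ *: (f _ - _)).
  by rewrite [h *: 1]mulr1 scalerDl addrCA.
apply: DeriveDef; first by rewrite /derivable E.
by rewrite /derive E.
Qed.

Lemma mvt_line {R : realType} {V : normedModType R} (f : V -> R)
    (x v : V) (h : R) :
  0 < h -> (forall y, derivable f y v) ->
  exists2 c, 0 < c < h & f (x + h *: v) - f x = h * 'D_v f (x + c *: v).
Proof.
move=> h0 df.
have dl (s : R) := is_derive_line (df (x + s *: v)).
have [|c ch] := MVT h0 (fun s _ => dl s).
  apply: continuous_subspaceT => s.
  apply/differentiable_continuous/derivable1_diffP.
  exact: (ex_derive (is_derive := dl s)).
rewrite scale0r addr0 subr0 mulrC => cE.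
by exists c; rewrite // -in_itv.
Qed.

(** Two mean value steps: first along u for the increment of f in the
    direction h v, then along v for 'D_u f.  The left-hand side is symmetric in
    u and v, which is what forces the mixed derivatives to agree. *)
Lemma second_difference {R : realType} {V : normedModType R} (f : V -> R)
    (x u v : V) (h : R) :
  0 < h -> (forall y, derivable f y u) -> (forall y, derivable ('D_u f) y v) ->
  exists c d, [/\ 0 < c < h, 0 < d < h &
    f (x + h *: u + h *: v) - f (x + h *: u) - f (x + h *: v) + f x
      = h ^+ 2 * 'D_v ('D_u f) (x + c *: u + d *: v)].
Proof.
move=> h0 dfu dfuv.
pose g y := f (y + h *: v) - f y.
have dg y : is_derive y u g ('D_u f (y + h *: v) - 'D_u f y).
  apply: is_deriveB; last exact: derivableP.
  have := derivableP (dfu (y + h *: v)).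
  have E : (fun r : R => r^-1 *: ((f \o shift (y + h *: v)) (r *: u) - f (y + h *: v)))
    = (fun r : R => r^-1 *:
        (((fun z => f (z + h *: v)) \o shift y) (r *: u) - f (y + h *: v))).
    by apply/funext => r /=; rewrite addrA.
  by case=> [+ +]; rewrite /derivable /derive E => ? ?; apply: DeriveDef.
have dg' y : derivable g y u by exact: (ex_derive (is_derive := dg y)).
have [c ch gE] := mvt_line x h0 dg'.
have [d dh dE] := mvt_line (x + c *: u) h0 dfuv.
exists c, d; split=> //.
rewrite expr2 -mulrA -dE -(derive_val (is_derive := dg _)) -gE /g.
ring.
Qed.

Lemma eq_of_equal_nearby {R : realType} {V : normedModType R} (f g : V -> R)
    (x : V) :
  {for x, continuous f} -> {for x, continuous g} ->
  (forall r : R, 0 < r ->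
     exists y z, [/\ `|x - y| < r, `|x - z| < r & f y = g z]) ->
  f x = g x.
Proof.
move=> cf cg near_eq.
apply/eqP; rewrite -subr_eq0 -normr_le0; apply/ler_addgt0Pl => e e0.
rewrite addr0.
have e2 : 0 < e / 2 by rewrite divr_gt0.
have /cvgrPdist_lt/(_ _ e2)/nbhs_normP[r /= r0 hr] := cf.
have /cvgrPdist_lt/(_ _ e2)/nbhs_normP[s /= s0 hs] := cg.
have m0 : 0 < Num.min r s by rewrite lt_min r0.
have [y [z [xy xz fygz]]] := near_eq _ m0.
move: xy xz; rewrite !lt_min => /andP[xy _] /andP[_ xz].
rewrite (le_trans (ler_distD (f y) _ _))// (splitr e) lerD//.
  by apply/ltW/hr.
by rewrite fygz distrC; apply/ltW/hs.
Qed.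

(** The second difference of size h equals h^2 times either mixed derivative at
    some point within h (|u| + |v|) of x, so the two derivatives share values
    arbitrarily close to x. *)
Lemma schwarz_symmetry {R : realType} {V : normedModType R} (f : V -> R)
    (x u v : V) :
  (forall y, derivable f y u) -> (forall y, derivable f y v) ->
  (forall y, derivable ('D_u f) y v) -> (forall y, derivable ('D_v f) y u) ->
  {for x, continuous ('D_v ('D_u f))} -> {for x, continuous ('D_u ('D_v f))} ->
  'D_v ('D_u f) x = 'D_u ('D_v f) x.
Proof.
move=> dfu dfv dfuv dfvu cuv cvu.
apply: eq_of_equal_nearby cuv cvu _ => m m0.
have D0 : 0 < `|u| + `|v| + 1 by rewrite ltr_pwDr.
pose h := m / (`|u| + `|v| + 1).
have h0 : 0 < h by rewrite divr_gt0.
have close c d a b : 0 < c < h -> 0 < d < h ->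
    `|a| + `|b| <= `|u| + `|v| -> `|x - (x + c *: a + d *: b : V)| < m.
  move=> /andP[c0 ch] /andP[d0 dh] ab.
  rewrite -addrA opprD addNKr normrN.
  apply: (le_lt_trans (ler_normD _ _)).
  rewrite !normrZ !gtr0_norm//.
  apply: (@le_lt_trans _ _ (h * (`|u| + `|v|))).
    apply: le_trans (ler_wpM2l (ltW h0) ab).
    by rewrite mulrDr lerD// ler_wpM2r// ltW.
  by rewrite /h mulrAC ltr_pdivrMr// ltr_pM2l// ltrDl.
have [c [d [ch dh E1]]] := second_difference x h0 dfu dfuv.
have [c' [d' [ch' dh' E2]]] := second_difference x h0 dfv dfvu.
exists (x + c *: u + d *: v), (x + c' *: v + d' *: u); split.
- exact: close.
- by apply: close => //; rewrite addrC.
have h20 : h ^+ 2 != 0 by rewrite expf_neq0// gt_eqF.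
(* E1 and E2 compute the same second difference, with the increments added in
   either order. *)
have cancel_sqr (a b p q s z : R) : p - q - s + z = h ^+ 2 * a ->
    p - s - q + z = h ^+ 2 * b -> a = b.
  by move=> pa pb; apply: (mulfI h20); rewrite -pa -pb (addrAC p).
rewrite (addrAC x (h *: v) (h *: u)) in E2; exact: cancel_sqr E1 E2.
Qed.

Lemma entry_le_enorm {R : realType} {d : nat} (v : 'cV[R]_d) a :
  `|v a 0| <= enorm v.
Proof.
rewrite -sqrtr_sqr ler_sqrt ?sumr_ge0// => [|i _]; last exact: sqr_ge0.
by rewrite (bigD1 a)//= lerDl sumr_ge0// => i _; exact: sqr_ge0.
Qed.

Lemma enorm_ge0 {R : realType} {d : nat} (v : 'cV[R]_d) : 0 <= enorm v.
Proof. exact: sqrtr_ge0. Qed.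

Lemma enormZ {R : realType} {d : nat} (c : R) (v : 'cV[R]_d) :
  enorm (c *: v) = `|c| * enorm v.
Proof.
rewrite /enorm -sqrtr_sqr -sqrtrM ?sqr_ge0// mulr_sumr.
by congr Num.sqrt; apply: eq_bigr => i _; rewrite mxE exprMn.
Qed.

Lemma enorm_delta {R : realType} {d : nat} (j : 'I_d) :
  enorm (delta_mx j 0 : 'cV[R]_d) = 1.
Proof.
rewrite /enorm (bigD1 j)//= big1 => [|i /negPf ij]; rewrite !mxE ?eqxx/=.
  by rewrite addr0 expr1n sqrtr1.
by rewrite ij expr0n.
Qed.

(** The supremum of an unbounded set is 0 by convention; otherwise it
    is at least the value at the zero vector, which is nonnegative. *)
Lemma opnorm_ge0 {R : realType} {d : nat} (A : 'M[R]_d) : 0 <= opnorm A.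
Proof.
rewrite /opnorm; set S := [set _ | _ in _].
have [[_ bS]|nS] := pselect (has_sup S); last by rewrite sup_out.
have S0 : S (enorm (A *m 0)).
  by exists 0 => //=; rewrite -(scale0r 0) enormZ normr0 mul0r.
by apply: le_trans (ub_le_sup bS S0); exact: enorm_ge0.
Qed.

(** The continuity of the mixed derivatives is read off entry by entry from
    that of the matrix-valued Hessian. *)
Lemma hess_sym {R : realType} {d : nat} (E : 'cV[R]_d -> R) x :
  twice_continuously_differentiable E -> (hess E x)^T = hess E x.
Proof.
move=> [dE dgE chE].
have gE i : (fun y => grad E y i 0) = 'D_(delta_mx i 0) E.
  by apply/funext => y; rewrite mxE.
have dgc y v i : derivable ('D_(delta_mx i 0) E) y v.
  by rewrite -gE; apply/(derivable_mxP (grad E) y v).1/diff_derivable.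
have ch i j : {for x, continuous ('D_(delta_mx j 0) ('D_(delta_mx i 0) E))}.
  rewrite (_ : 'D_(delta_mx j 0) _ = fun y => hess E y i j).
    exact: (continuous_comp (chE x) (@coord_continuous _ _ _ i j _)).
  by apply/funext => y; rewrite mxE gE.
apply/matrixP => i j; rewrite !mxE !gE.
by apply: schwarz_symmetry => // y; exact: diff_derivable.
Qed.

Lemma derive_le_lipschitz {R : realType} {V : normedModType R} (f : V -> R)
    (x v : V) (K : R) :
  derivable f x v -> (forall h, `|f (x + h *: v) - f x| <= K * `|h|) ->
  `|'D_v f x| <= K.
Proof.
move=> df fK.
have cf : (`|h^-1 *: ((f \o shift x) (h *: v) - f x)| : R)
    @[h --> (0 : R)^'] --> `|'D_v f x|.
  exact: cvg_norm df.
apply: cvgr_to_le cf _; near=> h.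
have h0 : h != 0 by near: h; exact: nbhs_dnbhs_neq.
rewrite normrM normfV ler_pdivrMl ?normr_gt0// mulrC /=.
by rewrite (addrC (h *: v)) fK.
Unshelve. all: by end_near. Qed.

(** An entry of the Hessian is the derivative of a component of the gradient
    along a unit vector. *)
Lemma hess_entry_le {R : realType} {d : nat} (E : 'cV[R]_d -> R) (L : R) x i j :
  twice_continuously_differentiable E ->
  (forall y z, enorm (grad E z - grad E y) <= L * enorm (z - y)) ->
  `|hess E x i j| <= L.
Proof.
move=> [_ dgE _] gL; rewrite mxE; apply: derive_le_lipschitz.
  by apply/(derivable_mxP (grad E) x _).1/diff_derivable.
move=> h.
have := gL x (x + h *: delta_mx j 0).
rewrite addrAC subrr add0r enormZ enorm_delta mulr1; apply: le_trans.
by have := entry_le_enorm (grad E (x + h *: delta_mx j 0) - grad E x) i; rewrite !mxE.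
Qed.

Lemma enorm_le_sum {R : realType} {d : nat} (v : 'cV[R]_d) :
  enorm v <= \sum_a `|v a 0|.
Proof.
have S0 (P : pred 'I_d) : 0 <= \sum_(a | P a) `|v a 0| by rewrite sumr_ge0.
rewrite -[leRHS]ger0_norm// -sqrtr_sqr ler_sqrt ?sqr_ge0//.
rewrite expr2 mulr_suml ler_sum// => a _.
rewrite -real_normK ?num_real// expr2 ler_wpM2l// (bigD1 a)//= lerDl.
exact: S0.
Qed.

(** * Powers of a small parameter along a filter *)

Section BigO.
Context {R : realType} {I : Type} (F : set_system I) {FF : Filter F}.
Variable t : I -> R.
Hypothesis t_ge0 : \forall s \near F, 0 <= t s.
Hypothesis t_cvg0 : t @ F --> 0.

(** With a filter on a type of problem data, the constant C is automatically
    uniform in these data. *)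
Definition pow_bigO (m : nat) (f : I -> R) : Prop :=
  exists C, \forall s \near F, `|f s| <= C * t s ^+ m.

Lemma pow_bigO_near m f g :
  (\forall s \near F, f s = g s) -> pow_bigO m g -> pow_bigO m f.
Proof. by move=> fg [C gC]; exists C; apply: filterS2 fg gC => s ->. Qed.

Lemma pow_bigO_le m f g :
  (\forall s \near F, `|f s| <= `|g s|) -> pow_bigO m g -> pow_bigO m f.
Proof.
by move=> fg [C gC]; exists C; apply: filterS2 fg gC => s; exact: le_trans.
Qed.

Lemma pow_bigO_bounded C f : (\forall s \near F, `|f s| <= C) -> pow_bigO 0 f.
Proof. by move=> fC; exists C; apply: filterS fC => s; rewrite mulr1. Qed.

Lemma pow_bigO_cst c : pow_bigO 0 (fun=> c).
Proof. by apply: (pow_bigO_bounded (C := `|c|)); exact: nearW. Qed.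

Lemma pow_bigO_param : pow_bigO 1 t.
Proof.
by exists 1; apply: filterS t_ge0 => s t0; rewrite ger0_norm// mul1r.
Qed.

Lemma pow_bigOD m f g :
  pow_bigO m f -> pow_bigO m g -> pow_bigO m (fun s => f s + g s).
Proof.
move=> [C fC] [D gD]; exists (C + D); apply: filterS2 fC gD => s fs gs.
by rewrite mulrDl (le_trans (ler_normD _ _))// lerD.
Qed.

Lemma pow_bigON m f : pow_bigO m f -> pow_bigO m (fun s => - f s).
Proof. by apply: pow_bigO_le; apply: nearW => s; rewrite normrN. Qed.

Lemma pow_bigOB m f g :
  pow_bigO m f -> pow_bigO m g -> pow_bigO m (fun s => f s - g s).
Proof. by move=> ? ?; apply: pow_bigOD => //; exact: pow_bigON. Qed.

Lemma pow_bigOM m n f g :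
  pow_bigO m f -> pow_bigO n g -> pow_bigO (m + n) (fun s => f s * g s).
Proof.
move=> [C fC] [D gD]; exists (C * D); apply: filterS2 fC gD => s fs gs.
by rewrite exprD mulrACA normrM ler_pM.
Qed.

Lemma pow_bigO_sum (J : finType) (P : pred J) m (f : J -> I -> R) :
  (forall j, P j -> pow_bigO m (f j)) ->
  pow_bigO m (fun s => \sum_(j | P j) f j s).
Proof.
move=> fO.
have -> : (fun s => \sum_(j | P j) f j s)
  = \big[(fun g h s => g s + h s)/(fun=> 0)]_(j | P j) f j.
  by apply/funext => s; elim/big_rec2: _ => // j y g _ <-.
elim/big_ind: _ => //; last by move=> *; exact: pow_bigOD.
by exists 0; apply: nearW => s; rewrite normr0 mul0r.
Qed.

Lemma pow_bigOW m n f : (n <= m)%N -> pow_bigO m f -> pow_bigO n f.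
Proof.
move=> nm [C fC]; exists `|C|.
have /cvgrPdist_le/(_ 1 ltr01) small := t_cvg0.
apply: filterS3 fC t_ge0 small => s fs t0.
rewrite sub0r normrN ger0_norm// => t1.
apply: (le_trans fs); apply: (@le_trans _ _ (`|C| * t s ^+ m)).
  by rewrite ler_wpM2r ?exprn_ge0// ler_norm.
by rewrite ler_wpM2l// ler_wiXn2l.
Qed.

Lemma pow_bigO_small m f (e : R) :
  0 < e -> pow_bigO m.+1 f -> \forall s \near F, `|f s| <= e.
Proof.
move=> e0 /(@pow_bigOW m.+1 1 f isT)[C fC].
have D0 : 0 < `|C| + 1 by rewrite ltr_pwDr.
have eC0 : 0 < e / (`|C| + 1) by rewrite divr_gt0.
have /cvgrPdist_le/(_ _ eC0) small := t_cvg0.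
apply: filterS3 fC t_ge0 small => s fs t0.
rewrite sub0r normrN ger0_norm// ler_pdivlMr// mulrC => ts.
apply: (le_trans fs); apply: le_trans ts.
by rewrite ler_wpM2r// (le_trans (ler_norm C))// lerDl.
Qed.

(** Entrywise, so that every estimate on vectors reduces to the scalar calculus;
    vec_bigO_enorm recovers the Euclidean estimate. *)
Definition vec_bigO {d : nat} (m : nat) (f : I -> 'cV[R]_d) : Prop :=
  forall a, pow_bigO m (fun s => f s a 0).

Section VecBigO.
Context {d : nat}.
Implicit Types f g : I -> 'cV[R]_d.

Lemma vec_bigO_near m f g :
  (\forall s \near F, f s = g s) -> vec_bigO m g -> vec_bigO m f.
Proof.
by move=> fg gO a; apply: pow_bigO_near (gO a); apply: filterS fg => s ->.
Qed.

Lemma vec_bigOW m n f : (n <= m)%N -> vec_bigO m f -> vec_bigO n f.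
Proof. by move=> nm fO a; apply: pow_bigOW (fO a). Qed.

Lemma vec_bigOD m f g :
  vec_bigO m f -> vec_bigO m g -> vec_bigO m (fun s => f s + g s).
Proof.
move=> fO gO a; apply: pow_bigO_near (pow_bigOD (fO a) (gO a)).
by apply: nearW => s; rewrite mxE.
Qed.

Lemma vec_bigON m f : vec_bigO m f -> vec_bigO m (fun s => - f s).
Proof.
move=> fO a; apply: pow_bigO_near (pow_bigON (fO a)).
by apply: nearW => s; rewrite mxE.
Qed.

Lemma vec_bigOB m f g :
  vec_bigO m f -> vec_bigO m g -> vec_bigO m (fun s => f s - g s).
Proof. by move=> ? ?; apply: vec_bigOD => //; exact: vec_bigON. Qed.

Lemma vec_bigOZ m n (c : I -> R) f :
  pow_bigO m c -> vec_bigO n f -> vec_bigO (m + n) (fun s => c s *: f s).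
Proof.
move=> cO fO a; apply: pow_bigO_near (pow_bigOM cO (fO a)).
by apply: nearW => s; rewrite mxE.
Qed.

Lemma vec_bigO_sum (J : finType) (P : pred J) m (f : J -> I -> 'cV[R]_d) :
  (forall j, P j -> vec_bigO m (f j)) ->
  vec_bigO m (fun s => \sum_(j | P j) f j s).
Proof.
move=> fO a.
apply: pow_bigO_near (pow_bigO_sum (P := P) (f := fun j s => f j s a 0) _).
  by apply: nearW => s; rewrite summxE.
by move=> j Pj; exact: fO.
Qed.

Lemma vec_bigO_dot m n f g :
  vec_bigO m f -> vec_bigO n g -> pow_bigO (m + n) (fun s => dot (f s) (g s)).
Proof.
move=> fO gO.
apply: pow_bigO_near (pow_bigO_sum (P := xpredT) (f := fun a s => f s a 0 * g s a 0) _).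
  by apply: nearW => s; rewrite /dot mxE; apply: eq_bigr => a _; rewrite mxE.
by move=> a _; exact: pow_bigOM.
Qed.

Lemma vec_bigO_enorm m f : vec_bigO m f -> pow_bigO m (fun s => enorm (f s)).
Proof.
move=> fO.
apply: pow_bigO_le (pow_bigO_sum (P := xpredT) (f := fun a s => `|f s a 0|) _).
  apply: nearW => s; rewrite ger0_norm ?sqrtr_ge0// ger0_norm ?sumr_ge0//.
  exact: enorm_le_sum.
move=> a _; apply: pow_bigO_le (fO a).
by apply: nearW => s; rewrite normr_id.
Qed.

End VecBigO.
End BigO.

(** * The Euclidean inner product *)

Section Dot.
Context {R : realType} {d : nat}.
Implicit Types u v w : 'cV[R]_d.

Lemma dotE u v : dot u v = \sum_a u a 0 * v a 0.
Proof. by rewrite /dot mxE; apply: eq_bigr => a _; rewrite mxE. Qed.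

Lemma dotC u v : dot u v = dot v u.
Proof. by rewrite !dotE; apply: eq_bigr => a _; rewrite mulrC. Qed.

Lemma dotDl u v w : dot (u + v) w = dot u w + dot v w.
Proof. by rewrite /dot linearD mulmxDl mxE. Qed.

Lemma dotDr u v w : dot w (u + v) = dot w u + dot w v.
Proof. by rewrite !(dotC w) dotDl. Qed.

Lemma dotZl c u v : dot (c *: u) v = c * dot u v.
Proof. by rewrite /dot linearZ -scalemxAl mxE. Qed.

Lemma dotZr c u v : dot u (c *: v) = c * dot u v.
Proof. by rewrite !(dotC u) dotZl. Qed.

Lemma dotNl u v : dot (- u) v = - dot u v.
Proof. by rewrite -scaleN1r dotZl mulN1r. Qed.

Lemma dotNr u v : dot u (- v) = - dot u v.
Proof. by rewrite !(dotC u) dotNl. Qed.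

Lemma dotBl u v w : dot (u - v) w = dot u w - dot v w.
Proof. by rewrite dotDl dotNl. Qed.

Lemma dotBr u v w : dot w (u - v) = dot w u - dot w v.
Proof. by rewrite dotDr dotNr. Qed.

Lemma dot_sumr (J : finType) (P : pred J) u (f : J -> 'cV[R]_d) :
  dot u (\sum_(j | P j) f j) = \sum_(j | P j) dot u (f j).
Proof. by rewrite /dot mulmx_sumr summxE. Qed.

Lemma dot_suml (J : finType) (P : pred J) u (f : J -> 'cV[R]_d) :
  dot (\sum_(j | P j) f j) u = \sum_(j | P j) dot (f j) u.
Proof. by rewrite dotC dot_sumr; apply: eq_bigr => j _; rewrite dotC. Qed.

Lemma enorm_sqr u : enorm u ^+ 2 = dot u u.
Proof.
by rewrite sqr_sqrtr ?dotE// sumr_ge0// => a _; exact: sqr_ge0.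
Qed.

Lemma dot_sym_mulmx (A : 'M[R]_d) u v :
  A^T = A -> dot u (A *m v) = dot v (A *m u).
Proof.
by move=> sA; rewrite (dotC v) /dot trmx_mul sA mulmxA.
Qed.

Lemma outer_mulmx u v : (u *m u^T) *m v = dot u v *: u.
Proof.
by rewrite -mulmxA [u^T *m v]mx11_scalar mul_mx_scalar.
Qed.
End Dot.

Lemma unit_vec_bigO {R : realType} {I : Type} {d : nat} (F : set_system I)
    {FF : Filter F} (t : I -> R) (v : I -> 'cV[R]_d) :
  (\forall s \near F, dot (v s) (v s) = 1) -> vec_bigO F t 0 v.
Proof.
move=> v_unit a; apply: (@pow_bigO_bounded _ _ F _ t 1).
apply: filterS v_unit => s v1.
apply: le_trans (entry_le_enorm (v s) a) _.
by rewrite -(@expr_le1 _ 2)// ?enorm_sqr ?v1// enorm_ge0.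
Qed.

(** * Normalizing a perturbed unit vector *)

Section Normalization.
Context {R : realType} {I : Type} {d : nat} (F : set_system I) {FF : Filter F}.
Variables (t : I -> R) (v g r : I -> 'cV[R]_d).
Hypothesis t_ge0 : \forall s \near F, 0 <= t s.
Hypothesis t_cvg0 : t @ F --> 0.
Hypothesis v_unit : \forall s \near F, dot (v s) (v s) = 1.
Hypothesis gO : vec_bigO F t 0 g.
Hypothesis rO : vec_bigO F t 2 r.
Let w s := v s + t s *: g s + r s.

Let tO := pow_bigO_param t_ge0.

Let vO : vec_bigO F t 0 v.
Proof. exact: unit_vec_bigO. Qed.

Let wO : vec_bigO F t 0 w.
Proof.
apply: vec_bigOD; last exact: (vec_bigOW t_ge0 t_cvg0 _ rO).
by apply: vec_bigOD => //; apply: vec_bigOW ((vec_bigOZ tO gO)).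
Qed.

Let a s := dot (v s) (g s).

Let aO : pow_bigO F t 0 a.
Proof. exact: (vec_bigO_dot vO gO). Qed.

Let taO : pow_bigO F t 1 (fun s => t s * a s).
Proof. exact: (pow_bigOM tO aO). Qed.

(* |w|^2 = 1 + 2 t a + O(t^2), because v is a unit vector. *)
Let sqr_enormO :
  pow_bigO F t 2 (fun s => enorm (w s) ^+ 2 - 1 - 2 * (t s * a s)).
Proof.
apply: (pow_bigO_near (g := fun s => t s * t s * dot (g s) (g s)
    + (dot (v s + t s *: g s) (r s) + dot (r s) (w s)))).
  apply: filterS v_unit => s v1; rewrite enorm_sqr /w.
  rewrite !(dotDl, dotDr, dotZl, dotZr) (dotC (g s) (v s)) v1 /a; ring.
apply: pow_bigOD.
  apply: (pow_bigOM (m := 2) (n := 0)); last exact: (vec_bigO_dot gO gO).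
  exact: (pow_bigOM tO tO).
apply: pow_bigOD.
  apply: (vec_bigO_dot (m := 0) (n := 2)) => //; apply: vec_bigOD => //.
  by apply: vec_bigOW ((vec_bigOZ tO gO)).
exact: (vec_bigO_dot (m := 2) (n := 0)).
Qed.

Let sqr_enorm1O : pow_bigO F t 1 (fun s => enorm (w s) ^+ 2 - 1).
Proof.
apply: (pow_bigO_near (g := fun s =>
  (enorm (w s) ^+ 2 - 1 - 2 * (t s * a s)) + 2 * (t s * a s))).
  by apply: nearW => s; rewrite subrK.
apply: pow_bigOD; first exact: (pow_bigOW t_ge0 t_cvg0 _ sqr_enormO).
by apply: (pow_bigOM (m := 0) (n := 1)) => //; exact: pow_bigO_cst.
Qed.

(** The squared norm is 1 + O(t), hence eventually at least 1/2, hence at least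
    the square of 1/2. *)
Lemma near_enorm_ge_half : \forall s \near F, 2^-1 <= enorm (w s).
Proof.
have q0 : 0 < 2^-1 :> R by [].
have small : \forall s \near F, `|enorm (w s) ^+ 2 - 1| <= 2^-1.
  exact: (pow_bigO_small t_ge0 t_cvg0 q0 sqr_enorm1O).
apply: filterS small => s; rewrite ler_norml => /andP[le _].
have := enorm_ge0 (w s); nra.
Qed.

Let enorm1O : pow_bigO F t 1 (fun s => enorm (w s) - 1).
Proof.
apply: pow_bigO_le sqr_enorm1O; apply: nearW => s.
have := enorm_ge0 (w s); set y := enorm _ => y0.
rewrite (_ : y ^+ 2 - 1 = (y - 1) * (y + 1)); last by ring.
by rewrite normrM ler_peMr// ger0_norm ?addr_ge0// lerDr.
Qed.

(* 2 (y - 1) = (y^2 - 1) - (y - 1)^2 passes from the squared norm to the norm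
   without any expansion of the square root. *)
Let enorm2O : pow_bigO F t 2 (fun s => enorm (w s) - 1 - t s * a s).
Proof.
apply: (pow_bigO_near (g := fun s => 2^-1 *
  ((enorm (w s) ^+ 2 - 1 - 2 * (t s * a s))
   - (enorm (w s) - 1) * (enorm (w s) - 1)))).
  by apply: nearW => s; field.
apply: (pow_bigOM (m := 0) (n := 2)); first exact: pow_bigO_cst.
apply: pow_bigOB => //; exact: (pow_bigOM enorm1O enorm1O).
Qed.

(** To first order, normalization projects the perturbation g on the orthogonal
    complement of v. *)
Lemma normalize_expansion :
  vec_bigO F t 2 (fun s => (enorm (w s))^-1 *: w s - v s
                           - t s *: (g s - dot (v s) (g s) *: v s)).
Proof.
(* With y = |w| and h = g - a v, multiplying by y gives
   w - y v - y t h = r - (y - 1 - t a) v - (y - 1) t h, each term of which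
   is O(t^2). *)
apply: (vec_bigO_near (g := fun s => (enorm (w s))^-1 *:
    (r s - (enorm (w s) - 1 - t s * a s) *: v s
     - ((enorm (w s) - 1) * t s) *: (g s - a s *: v s)))).
  apply: filterS near_enorm_ge_half => s Yge.
  have Y0 : enorm (w s) != 0 by rewrite gt_eqF// (lt_le_trans _ Yge).
  apply: (scalerI Y0).
  rewrite !scalerBr !scalerA divff// !scale1r.
  apply/colP => b; rewrite /w !mxE -/(a s); ring.
have YO : pow_bigO F t 0 (fun s => (enorm (w s))^-1).
  apply: (@pow_bigO_bounded _ _ F _ t 2); apply: filterS near_enorm_ge_half => s Yge.
  have Y0 : 0 < enorm (w s) by rewrite (lt_le_trans _ Yge).
  by rewrite ger0_norm ?invr_ge0 ?enorm_ge0// -[leRHS]invrK lef_pV2// posrE.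
apply: (vec_bigOZ (m := 0) (n := 2)) => //.
apply: vec_bigOB; first apply: vec_bigOB => //.
  exact: (vec_bigOZ (m := 2) (n := 0)).
apply: (vec_bigOZ (m := 2) (n := 0)); first exact: (pow_bigOM enorm1O tO).
by apply: vec_bigOB => //; exact: (vec_bigOZ (m := 0) (n := 0)).
Qed.
End Normalization.

(** * Gram-Schmidt orthonormalization *)

Section GramSchmidt.
Context {R : realType} {d k : nat}.

Definition gs_residual (z u : 'I_k -> 'cV[R]_d) (i : 'I_k) : 'cV[R]_d :=
  z i - \sum_(j < k | (j < i)%N) dot (z i) (u j) *: u j.

(** The defining equations are implicit here: u occurs in its own residuals,
    through the indices j < i only, as in the numerical scheme. *)
Lemma gram_schmidt_orthonormal (z u : 'I_k -> 'cV[R]_d) :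
  (forall i, enorm (gs_residual z u i) != 0) ->
  (forall i, u i = (enorm (gs_residual z u i))^-1 *: gs_residual z u i) ->
  orthonormal_family u.
Proof.
move=> w0 uE.
have u1 i : dot (u i) (u i) = 1.
  by rewrite uE dotZl dotZr -enorm_sqr expr2 mulKf ?mulVf.
(* Only the larger index i is bounded by n: the induction hypothesis then gives
   orthogonality for all pairs of indices below i. *)
have ortho n (i j : 'I_k) : (i < n)%N -> (j < i)%N -> dot (u i) (u j) = 0.
  elim: n i j => // n IH i j; rewrite ltnS => i_n ji.
  have {}IH (l : 'I_k) : (l < i)%N -> l != j -> dot (u l) (u j) = 0.
    move=> li lj; case: (ltngtP l j) => [lj'|jl|/val_inj e].
    - by rewrite dotC (IH j l)// (leq_trans ji).
    - by rewrite (IH l j)// (leq_trans li).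
    - by rewrite e eqxx in lj.
  rewrite uE dotZl [X in _ * dot X _]/gs_residual dotBl dot_suml (bigD1 j)//=.
  rewrite big1 => [|l /andP[li lj]].
    by rewrite dotZl u1 mulr1 addr0 subrr mulr0.
  by rewrite dotZl IH// mulr0.
move=> i j; have [->|ij] := eqVneq i j; first exact: u1.
case: (ltngtP i j) => [lt|gt|/val_inj e].
- by rewrite dotC (ortho j.+1 j i (ltnSn j) lt).
- by rewrite (ortho i.+1 i j (ltnSn i) gt).
- by rewrite e eqxx in ij.
Qed.
End GramSchmidt.

(** * One step of the scheme *)

Section Step.
Context {R : realType} {d k : nat}.

(** The data of one step, gathered in a type so that they can be let vary
    simultaneously; new_frame is data, tied to the others by admissible_step. *)
Record gs_step := GsStep {
  step_size : R;
  step_mx : 'M[R]_d;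
  old_frame : 'I_k -> 'cV[R]_d;
  new_frame : 'I_k -> 'cV[R]_d }.

Definition moved_frame (s : gs_step) (i : 'I_k) : 'cV[R]_d :=
  old_frame s i + step_size s *: (step_mx s *m old_frame s i).

Definition step_residual (s : gs_step) : 'I_k -> 'cV[R]_d :=
  gs_residual (moved_frame s) (new_frame s).

Definition admissible_step (M : R) (s : gs_step) : Prop :=
  [/\ 0 < step_size s, (step_mx s)^T = step_mx s,
      forall a b, `|step_mx s a b| <= M,
      orthonormal_family (old_frame s)
    & forall i, new_frame s i = (enorm (step_residual s i))^-1 *: step_residual s i].

(** First-order term of the residual before normalization. *)
Definition drift (A : 'M[R]_d) (v : 'I_k -> 'cV[R]_d) (i : 'I_k) : 'cV[R]_d :=
  A *m v i - 2 *: \sum_(j < k | (j < i)%N) dot (v j) (A *m v i) *: v j.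

Definition velocity (A : 'M[R]_d) (v : 'I_k -> 'cV[R]_d) (i : 'I_k) : 'cV[R]_d :=
  drift A v i - dot (v i) (A *m v i) *: v i.

Definition small_steps (M : R) : set_system gs_step :=
  filter_from [set e : R | 0 < e]
    (fun e => [set s | admissible_step M s /\ step_size s <= e]).

Lemma small_steps_filter M : Filter (small_steps M).
Proof.
apply: filter_from_filter; first by exists 1 => /=.
move=> e f e0 f0; exists (Num.min e f); first by rewrite /= lt_min e0.
by move=> s [Ms]; rewrite le_min => /andP[se sf].
Qed.
#[local] Existing Instance small_steps_filter.

Lemma near_admissible M : \forall s \near small_steps M, admissible_step M s.
Proof. by exists 1 => //= s []. Qed.

Lemma near_step_size_ge0 M : \forall s \near small_steps M, 0 <= step_size s.
Proof. by apply: filterS (near_admissible M) => s [/ltW]. Qed.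

Lemma step_size_cvg0 M : step_size @ small_steps M --> 0.
Proof.
apply/cvgrPdist_le => e e0; exists e => //= s [[s0 _ _ _ _] se].
by rewrite sub0r normrN gtr0_norm.
Qed.

Lemma orthonormal_dot0 (v : 'I_k -> 'cV[R]_d) (i j : 'I_k) :
  orthonormal_family v -> (j < i)%N -> dot (v i) (v j) = 0.
Proof. by move=> von ji; rewrite von -val_eqE /= (gtn_eqF ji). Qed.

Lemma dot_drift A (v : 'I_k -> 'cV[R]_d) i :
  orthonormal_family v -> dot (v i) (drift A v i) = dot (v i) (A *m v i).
Proof.
move=> von; rewrite /drift dotBr dotZr dot_sumr big1 ?mulr0 ?subr0// => j ji.
by rewrite dotZr (orthonormal_dot0 von ji) mulr0.
Qed.

(** Only the term A v_j of the velocity of v_j survives: the others are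
    combinations of v_l with l <= j < i. *)
Lemma dot_velocity A (v : 'I_k -> 'cV[R]_d) (i j : 'I_k) :
  orthonormal_family v -> A^T = A -> (j < i)%N ->
  dot (v i) (velocity A v j) = dot (v j) (A *m v i).
Proof.
move=> von sA ji; rewrite /velocity /drift !(dotBr, dotZr) dot_sumr big1.
  rewrite (orthonormal_dot0 von ji).
  by rewrite !mulr0 !subr0; exact: dot_sym_mulmx.
move=> l lj; have li := ltn_trans lj ji.
by rewrite dotZr (orthonormal_dot0 von li) mulr0.
Qed.

Section Expansion.
Variable M : R.
Let F := small_steps M.
#[local] Instance filterF : Filter F := small_steps_filter M.
Let t := @step_size.
Let q i s := step_mx s *m old_frame s i.

Let t_ge0 := near_step_size_ge0 M.
Let t_cvg0 := @step_size_cvg0 M.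
Let tO := pow_bigO_param t_ge0.

Let old_unit i : \forall s \near F, dot (old_frame s i) (old_frame s i) = 1.
Proof. by apply: filterS (near_admissible M) => s [_ _ _ ->]; rewrite eqxx. Qed.

Let oldO i : vec_bigO F t 0 (fun s => old_frame s i).
Proof. exact: unit_vec_bigO. Qed.

Let qO i : vec_bigO F t 0 (q i).
Proof.
move=> a.
apply: (pow_bigO_near (g := fun s => \sum_b step_mx s a b * old_frame s i b 0)).
  by apply: nearW => s; rewrite mxE.
apply: pow_bigO_sum => b _.
apply: (pow_bigOM (m := 0) (n := 0)); last exact: oldO.
apply: (@pow_bigO_bounded _ _ F _ t M).
by apply: filterS (near_admissible M) => s [_ _ + _ _]; apply.
Qed.

Let cO i j : pow_bigO F t 0 (fun s => dot (old_frame s j) (q i s)).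
Proof. exact: (vec_bigO_dot (oldO j) (qO i)). Qed.

Let driftO i : vec_bigO F t 0 (fun s => drift (step_mx s) (old_frame s) i).
Proof.
apply: vec_bigOB; first exact: qO.
apply: (vec_bigOZ (m := 0) (n := 0)); first exact: (pow_bigO_cst t 2).
by apply: vec_bigO_sum => j _; exact: (vec_bigOZ (cO i j) (oldO j)).
Qed.

Let velocityO i : vec_bigO F t 0 (fun s => velocity (step_mx s) (old_frame s) i).
Proof.
by apply: vec_bigOB; [exact: driftO | exact: (vec_bigOZ (cO i i) (oldO i))].
Qed.

Let expands i := vec_bigO F t 2 (fun s => new_frame s i - old_frame s i
  - step_size s *: velocity (step_mx s) (old_frame s) i).

Let newB_O i : expands i ->
  vec_bigO F t 1 (fun s => new_frame s i - old_frame s i).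
Proof.
move=> ei; apply: (vec_bigO_near (g := fun s =>
    (new_frame s i - old_frame s i
     - step_size s *: velocity (step_mx s) (old_frame s) i)
    + step_size s *: velocity (step_mx s) (old_frame s) i)).
  by apply: nearW => s; rewrite subrK.
apply: vec_bigOD; first exact: (vec_bigOW t_ge0 t_cvg0 _ ei).
exact: (vec_bigOZ tO (velocityO i)).
Qed.

Let newO i : expands i -> vec_bigO F t 0 (fun s => new_frame s i).
Proof.
move=> /newB_O nO; apply: (vec_bigO_near (g := fun s =>
    (new_frame s i - old_frame s i) + old_frame s i)).
  by apply: nearW => s; rewrite subrK.
by apply: vec_bigOD => //; exact: (vec_bigOW t_ge0 t_cvg0 _ nO).
Qed.

(* With e_j the error in the expansion of u_j, the difference is
   v_i . e_j + tau (A v_i) . (u_j - v_j); the two equal first-order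
   contributions v_i . A v_j and v_j . A v_i account for the 2. *)
Let dot_moved_new (i j : 'I_k) : (j < i)%N -> expands j ->
  pow_bigO F t 2 (fun s => dot (moved_frame s i) (new_frame s j)
                   - 2 * (step_size s * dot (old_frame s j) (q i s))).
Proof.
move=> ji ej.
apply: (pow_bigO_near (g := fun s =>
    dot (old_frame s i) (new_frame s j - old_frame s j
      - step_size s *: velocity (step_mx s) (old_frame s) j)
    + step_size s * dot (q i s) (new_frame s j - old_frame s j))).
  apply: filterS (near_admissible M) => s [_ sA _ von _].
  have vij : dot (old_frame s i) (old_frame s j) = 0.
    exact: orthonormal_dot0 von ji.
  have := dot_velocity von sA ji; rewrite -/(q i s).
  move: (velocity _ _ j) => p vip.
  rewrite /moved_frame -/(q i s) !(dotDl, dotZl, dotBr, dotZr) vip vij.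
  by rewrite (dotC (q i s) (old_frame s j)); ring.
apply: pow_bigOD; first exact: (vec_bigO_dot (oldO i) ej).
exact: (pow_bigOM tO (vec_bigO_dot (qO i) (newB_O ej))).
Qed.

Let projection_O (i j : 'I_k) : (j < i)%N -> expands j ->
  vec_bigO F t 2 (fun s => dot (moved_frame s i) (new_frame s j) *: new_frame s j
    - (2 * (step_size s * dot (old_frame s j) (q i s))) *: old_frame s j).
Proof.
move=> ji ej.
pose c s := 2 * (step_size s * dot (old_frame s j) (q i s)).
apply: (vec_bigO_near (g := fun s =>
    (dot (moved_frame s i) (new_frame s j) - c s) *: new_frame s j
    + c s *: (new_frame s j - old_frame s j))).
  by apply: nearW => s; rewrite scalerBl scalerBr addrA subrK.
apply: vec_bigOD; first exact: (vec_bigOZ (dot_moved_new ji ej) (newO ej)).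
apply: (vec_bigOZ (m := 1) (n := 1)); last exact: newB_O.
apply: (pow_bigOM (m := 0) (n := 1)); first exact: (pow_bigO_cst t 2).
exact: (pow_bigOM tO (cO i j)).
Qed.

Let r i s := step_residual s i - old_frame s i
  - step_size s *: drift (step_mx s) (old_frame s) i.

Let rO (i : 'I_k) : (forall j : 'I_k, (j < i)%N -> expands j) ->
  vec_bigO F t 2 (r i).
Proof.
move=> ei; apply: (vec_bigO_near (g := fun s => - \sum_(j < k | (j < i)%N)
    (dot (moved_frame s i) (new_frame s j) *: new_frame s j
    - (2 * (step_size s * dot (old_frame s j) (q i s))) *: old_frame s j))).
  apply: nearW => s; rewrite /r /step_residual /gs_residual sumrB opprB.
  rewrite /drift -/(q i s) /moved_frame -/(q i s).
  have -> : \sum_(j < k | (j < i)%N) (2 * (step_size s * dot (old_frame s j) (q i s)))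
      *: old_frame s j
    = step_size s *: (2 *: \sum_(j < k | (j < i)%N) dot (old_frame s j) (q i s)
                        *: old_frame s j).
    rewrite !scaler_sumr; apply: eq_bigr => j _.
    by rewrite !scalerA mulrCA mulrA.
  by apply/colP => a; rewrite !mxE; ring.
apply: vec_bigON; apply: vec_bigO_sum => j ji.
by apply: projection_O => //; exact: ei.
Qed.

Let residualE i s : step_residual s i = old_frame s i
  + step_size s *: drift (step_mx s) (old_frame s) i + r i s.
Proof. by rewrite /r addrC -(addrA (step_residual s i)) -opprD subrK. Qed.

(** Strong induction on the index: the residual of index i involves the new
    vectors of smaller index only. *)
Lemma new_frame_expansion i : expands i.
Proof.
have [n] := ubnP (nat_of_ord i); elim: n i => // n IH i; rewrite ltnS => i_n.
have ri : vec_bigO F t 2 (r i).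
  by apply: rO => j ji; apply: IH; exact: leq_trans ji i_n.
apply: vec_bigO_near (normalize_expansion t_ge0 t_cvg0 (old_unit i) (driftO i) ri).
apply: filterS (near_admissible M) => s [_ _ _ von ->].
by rewrite residualE /velocity dot_drift.
Qed.

(** For small steps the residuals are perturbed unit vectors, so they do not
    vanish and Gram-Schmidt does not break down. *)
Lemma near_new_frame_orthonormal :
  \forall s \near F, orthonormal_family (new_frame s).
Proof.
have w0 i : \forall s \near F, 2^-1 <= enorm (step_residual s i).
  have ri : vec_bigO F t 2 (r i) by apply: rO => j _; exact: new_frame_expansion.
  apply: filterS (near_enorm_ge_half t_ge0 t_cvg0 (old_unit i) (driftO i) ri).
  by move=> s; rewrite residualE.
apply: filterS2 (near_admissible M) (filter_forall _ w0) => s [_ _ _ _ uE] ws.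
apply: gram_schmidt_orthonormal uE => i.
by rewrite gt_eqF// (lt_le_trans _ (ws i)).
Qed.
End Expansion.
End Step.

(** The filter estimates with their constants made explicit; e and C depend on
    d, k and M only. *)
Lemma gs_step_uniform (R : realType) (d k : nat) (M : R) :
  exists e C : R, 0 < e /\ forall s : @gs_step R d k,
    admissible_step M s -> step_size s <= e ->
    orthonormal_family (new_frame s) /\
    forall i, enorm (new_frame s i - old_frame s i
        - step_size s *: velocity (step_mx s) (old_frame s) i)
      <= C * step_size s ^+ 2.
Proof.
have FF := @small_steps_filter R d k M.
have errO i := vec_bigO_enorm (@new_frame_expansion R d k M i).
have [C errC] := pow_bigO_sum (P := xpredT) (fun i _ => errO FF i).
have [e e0 eP] := filterI (near_new_frame_orthonormal M) errC.
exists e, C; split=> // s Ms se; have [son sC] := eP s (conj Ms se).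
split=> // i; apply: le_trans sC.
rewrite ger0_norm ?sumr_ge0// => [|j _]; last exact: enorm_ge0.
by rewrite (bigD1 i)//= lerDl sumr_ge0// => j _; exact: enorm_ge0.
Qed.

Lemma velocityE (R : realType) (d k : nat) (J : 'cV[R]_d -> 'M[R]_d)
    (gamma : R) (x : 'cV[R]_d) (v : 'I_k -> 'cV[R]_d) (i : 'I_k) :
  velocity (gamma *: J x) v i = Rterm J gamma x v i + Lterm J gamma x v i.
Proof.
rewrite /velocity /drift /Rterm /Lterm -scalemxAl.
move: (J x *m v i) => w.
rewrite mulmxBl mulNmx outer_mulmx -scalemxAl mulmx_suml scalerBr scalerN.
rewrite dotZr -scalerA addrA addrAC; congr (_ - _ - _).
rewrite !scaler_sumr; apply: eq_bigr => j _.
by rewrite outer_mulmx dotZr !scalerA mulrCA mulrA.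
Qed.

(** * Consistency of the scheme *)

Theorem theorem2p1 (R : realType) (d k : nat) (E : 'cV[R]_d -> R)
    (F : 'cV[R]_d -> 'cV[R]_d) (J : 'cV[R]_d -> 'M[R]_d)
    (T beta gamma : R) (x0 : 'cV[R]_d) (v0 : 'I_k -> 'cV[R]_d)
    (hE : twice_continuously_differentiable E)
    (hF : forall x, F x = - grad E x)
    (hJ : forall x, J x = - hess E x)
    (hA : assumptionA F J)
    (hT : 0 < T) (hk : (1 <= k <= d)%N)
    (hbeta : 0 < beta) (hgamma : 0 < gamma)
    (hv0 : orthonormal_family v0) :
  exists tau0 Q : R, [/\ 0 < tau0, 0 < Q &
    forall N : nat, (0 < N)%N ->
    forall tau : R, tau = T / N%:R -> tau <= tau0 ->
    forall (x : nat -> 'cV[R]_d) (v : 'I_k -> nat -> 'cV[R]_d),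
      x 0%N = x0 -> (forall i, v i 0%N = v0 i) ->
      hisd_scheme F J beta gamma tau N x v ->
    forall (n : nat) (i : 'I_k), (1 <= n <= N)%N ->
      enorm (tau^-1 *: (v i n - v i n.-1)
             - Rterm J gamma (x n.-1) (fun j => v j n.-1) i
             - Lterm J gamma (x n.-1) (fun j => v j n.-1) i) <= Q * tau].
Proof.
have [L L0 [lip _]] := hA.
have grad_lip y z : enorm (grad E z - grad E y) <= L * enorm (z - y).
  have -> : grad E z - grad E y = (-1) *: (F z - F y).
    by rewrite !hF scaleN1r opprB opprK addrC.
  rewrite enormZ normrN1 mul1r; apply: le_trans (lip y z).
  by rewrite lerDr opnorm_ge0.
have [e [C [e0 one_step]]] := @gs_step_uniform R d k (gamma * L).
exists e, (`|C| + 1); split=> //.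
move=> N N0 tau tauE tau_e x v _ v_init scheme.
have tau0 : 0 < tau by rewrite tauE divr_gt0// ltr0n.
pose s n := GsStep tau (gamma *: J (x n.-1)) (v^~ n.-1) (v^~ n).
have admissible n : (1 <= n <= N)%N -> orthonormal_family (v^~ n.-1) ->
    admissible_step (gamma * L) (s n).
  move=> nN von; have [_ vE] := scheme n nN; split=> //=.
  - by rewrite linearZ /= hJ linearN /= hess_sym.
  - move=> a b; rewrite [X in `|X|]mxE normrM gtr0_norm// (ler_wpM2l (ltW hgamma))//.
    by rewrite hJ [X in `|X|]mxE normrN; exact: hess_entry_le.
  - move=> i; rewrite /step_residual /gs_residual /moved_frame /=.
    by rewrite {1}vE /= -!scalemxAl !scalerA.
(* The same bound on tau serves at each n, so the induction never
   shrinks it. *)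
have von n : (n <= N)%N -> orthonormal_family (v^~ n).
  elim: n => [_ i j|n IH nN]; first by rewrite !v_init.
  by have [] := one_step (s n.+1) (admissible n.+1 nN (IH (ltnW nN))) tau_e.
move=> n i nN; have n1N : (n.-1 <= N)%N.
  by rewrite (leq_trans (leq_pred n))//; case/andP: nN.
have [_ /(_ i)/= err] := one_step (s n) (admissible n nN (von _ n1N)) tau_e.
rewrite velocityE in err.
set r := Rterm _ _ _ _ _ in err *; set l := Lterm _ _ _ _ _ in err *.
have -> : tau^-1 *: (v i n - v i n.-1) - r - l
    = tau^-1 *: (v i n - v i n.-1 - tau *: (r + l)).
  by rewrite [RHS]scalerBr scalerA mulVf ?gt_eqF// scale1r opprD addrA.
rewrite enormZ gtr0_norm ?invr_gt0// ler_pdivrMl//.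
apply: (le_trans err); rewrite [leRHS]mulrCA -expr2 ler_wpM2r ?sqr_ge0//.
by rewrite (le_trans (ler_norm C))// lerDl.
Qed.
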